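(* Let $T_0>0$ and let $(F,\Psi,\mathfrak{P})$ be a Wu solution on $[0,T_0]$ (as defined in the context), with associated Lagrangian-to-conformal homeomorphisms $h(\cdot,t):\mathbb{R}\to\mathbb{R}$. For $t\in[0,T_0]$ let $S(t)=\{\alpha'\in\mathbb{R} : \frac{1}{\Psi_{z'}}(\alpha',t)=0\}$. Then for every $t\in[0,T_0]$, $$S(t)=\{h(\alpha,t) : \alpha\in S(0)\}.$$
   Context: **Notation.** Identify $\mathbb{R}^2$ with $\mathbb{C}$. $P_-=\{z'=x'+iy' : y'<0\}$ is the lower half plane, $\overline{P}_-$ its closure, with boundary $\mathbb{R}$. $\partial_{z'}=\frac12(\partial_{x'}-i\partial_{y'})$; subscripts $t,z',\alpha,\alpha'$ denote partial derivatives (except in the symbols $Z_t,Z_{tt}$, defined below). $\|\cdot\|_p$ is the $L^p(\mathbb{R})$ norm; $\|f\|_{\dot H^{1/2}}=\||\xi|^{1/2}\hat f\|_2$. $K_y(x)=\frac{-y}{\pi(x^2+y^2)}$ for $y<0$ is the Poisson kernel; $*$ is convolution in the real variable. Compositions and inverses are in the spatial variable. $f_\epsilon\Rightarrow f$ on $U$ means uniform convergence on compact subsets of $U$. $C(\cdot)$ denotes finite quantities depending only on the indicated arguments. Convention: if a function (or a product such as $\frac{1}{\Psi_{z'}}F_{z'}$) defined on $P_-$ extends continuously to $\overline{P}_-$, its value at a boundary point is that of the continuous extension. **Water wave system in $P_-$.** For $F,\Psi$ complex valued and $\mathfrak P$ real valued: (i) $F_t-\Psi_t\frac{F_{z'}}{\Psi_{z'}}+\overline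 F\frac{F_{z'}}{\Psi_{z'}}=-\frac{1}{\Psi_{z'}}(\partial_{x'}-i\partial_{y'})\mathfrak P+i$ on $P_-$; (ii) $F(\cdot,t)$ holomorphic and $\Psi(\cdot,t)$ conformal on $P_-$; (iii) $\mathfrak P=0$ on $\partial P_-$; (iv) the trace of $\frac{1}{\Psi_{z'}}(\overline F-\Psi_t)$ on $\partial P_-$ is real valued; with $F\to0$, $(\partial_{x'}-i\partial_{y'})\mathfrak P\to i$, $\Psi_{z'}\to1$, $\Psi_t\to0$ as $z'\to\infty$. **Energy.** All norms are in $x'$ at height $y'$: $\mathcal E_1(t)=\sup_{y'<0}\|F_{z'}\|_{L^2}^2+\sup_{y'<0}\|\frac{1}{\Psi_{z'}}F_{z'}\|_{\dot H^{1/2}}^2+\sup_{y'<0}\|\frac{1}{\Psi_{z'}}\partial_{z'}(\frac{1}{\Psi_{z'}}F_{z'})\|_{L^2}^2+\sup_{y'<0}\|\frac{1}{\Psi_{z'}^2}\partial_{z'}(\frac{1}{\Psi_{z'}}F_{z'})\|_{\dot H^{1/2}}^2+\sup_{y'<0}\|\frac{1}{\Psi_{z'}}\|_{L^\infty}^2+\sup_{y'<0}\|\partial_{z'}(\frac{1}{\Psi_{z'}})\|_{L^2}^2+\sup_{y'<0}\|\frac{1}{\Psi_{z'}}\partial_{z'}(\frac{1}{\Psi_{z'}}\partial_{z'}(\frac{1}{\Psi_{z'}}))\|_{L^2}^2$. **Initial data.** $F(\cdot,0),\Psi(\cdot,0)$ are holomorphic on $P_-$, $\Psi(\cdot,0)$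 is conformal onto a domain whose boundary is a Jordan curve, $\Psi_{z'}(z',0)\to1$ as $z'\to\infty$; $\mathfrak P(\cdot,0)$ is the unique solution of $\Delta\mathfrak P=-2|F_{z'}|^2$ on $P_-$, $\mathfrak P=0$ on $\partial P_-$, $(\partial_{x'}+i\partial_{y'})\mathfrak P\to-i$ at infinity; and $\mathcal E_1(0)<\infty$, $c_0:=\sup_{y'<0}\|F(\cdot+iy',0)\|_{L^2}+\sup_{y'<0}\|\frac{1}{\Psi_{z'}(\cdot+iy',0)}-1\|_{L^2}<\infty$. **Wu solution on $[0,T_0]$.** This is a solution produced by Wu's existence theorem from such data. Concretely it is a solution $(F,\Psi,\mathfrak P)$ of the system on $[0,T_0]$ with the following properties. (1) $\Psi$ is $C^1$ on $P_-\times[0,T_0]$, each $\Psi(\cdot,t)$ is conformal, and $\Psi,\frac1{\Psi_{z'}},\frac{\Psi_t}{\Psi_{z'}}$ are continuous on $\overline P_-\times[0,T_0]$; $F$ is bounded and continuous on $\overline P_-\times[0,T_0]$, $C^1$ on $P_-\times[0,T_0]$, each $F(\cdot,t)$ holomorphic; $\mathfrak P$ is continuous on $\overline P_-\times[0,T_0]$ and $C^1$ on $P_-\times[0,T_0]$; for all $t$, $\mathcal E_1(t)<\infty$ and $\sup_{y'<0}\|F(\cdot+iy',t)\|_{L^2}+\sup_{y'<0}\|\frac1{\Psi_{z'}(\cdot+iy',t)}-1\|_{L^2}<\infty$. (2) Smooth approximations. For each $0<\epsilon\le1$ there is a solution $(F^\epsilon,\Psi^\epsilon,\mathfrak P^\epsilon)$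 of the system on $[0,T_0]$, smooth up to the boundary, with $F^\epsilon(z',0)=F(z'-\epsilon i,0)$, $\Psi^\epsilon(z',0)=\Psi(z'-\epsilon i,0)$. Write $Z^\epsilon(\alpha',t)=\Psi^\epsilon(\alpha',t)$, $Z^\epsilon_{,\alpha'}=\partial_{\alpha'}Z^\epsilon$, $Z_t^\epsilon=\overline{F^\epsilon}|_{\mathbb R}$, $Z^\epsilon_{t,\alpha'}=\partial_{\alpha'}Z^\epsilon_t$, $b^\epsilon=\frac{1}{\Psi^\epsilon_{z'}}(\overline{F^\epsilon}-\Psi^\epsilon_t)|_{\mathbb R}$; $h^\epsilon$ is the flow $h^\epsilon_t=b^\epsilon\circ h^\epsilon$, $h^\epsilon(\alpha,0)=\alpha$; $z^\epsilon=Z^\epsilon\circ h^\epsilon$ (so $z^\epsilon_t=Z_t^\epsilon\circ h^\epsilon$), $Z^\epsilon_{tt}=z^\epsilon_{tt}\circ(h^\epsilon)^{-1}$; $A_1^\epsilon(\alpha',t)=1+\frac1{2\pi}\int\frac{|Z_t^\epsilon(\alpha',t)-Z_t^\epsilon(\beta',t)|^2}{(\alpha'-\beta')^2}d\beta'$. On $\mathbb R$: $\frac{1}{\Psi^\epsilon_{z'}}(\partial_{x'}-i\partial_{y'})\mathfrak P^\epsilon=i\frac{A_1^\epsilon}{Z^\epsilon_{,\alpha'}}$ and $\overline{Z^\epsilon_{tt}}-i=-i\frac{A_1^\epsilon}{Z^\epsilon_{,\alpha'}}$. Moreover $\mathfrak P^\epsilon=-\frac12|F^\epsilon|^2-y'+\frac12K_{y'}*(|Z_t^\epsilon|^2)$.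 (3) Uniform bounds for all $0<\epsilon\le1$, $t\in[0,T_0]$: the quantities $\|Z^\epsilon_{t,\alpha'}\|_2$, $\|\partial_{\alpha'}\frac1{Z^\epsilon_{,\alpha'}}\|_2$, $\|A_1^\epsilon\|_\infty$, $\|\frac1{Z^\epsilon_{,\alpha'}}\partial_{\alpha'}A_1^\epsilon\|_2$, $\|b^\epsilon_{\alpha'}\|_\infty$, $\|\frac{h^\epsilon_{t\alpha}}{h^\epsilon_\alpha}\|_\infty$, $\|\frac{z^\epsilon_{t\alpha}}{z^\epsilon_\alpha}\|_\infty$, $\|\partial_{\alpha'}(\frac{1}{(Z^\epsilon_{,\alpha'})^2}Z^\epsilon_{t,\alpha'})\|_2$ (and the same with $\overline{Z^\epsilon_{t,\alpha'}}$ in place of $Z^\epsilon_{t,\alpha'}$) are at most $C(\mathcal E_1(0))$; $\|Z_t^\epsilon\|_\infty+\|\frac1{Z^\epsilon_{,\alpha'}}\|_\infty\le C(c_0,\mathcal E_1(0))$; and there are $0<c_1,c_2<\infty$ depending only on $\mathcal E_1(0)$ with $c_1\le|h^\epsilon_\alpha(\alpha,t)|\le c_2$, $c_1|z^\epsilon_\alpha(\alpha,0)|\le|z^\epsilon_\alpha(\alpha,t)|\le c_2|z^\epsilon_\alpha(\alpha,0)|$, $|z^\epsilon_{t\alpha}(\alpha,t)|\le c_2|z^\epsilon_\alpha(\alpha,0)|$. (4) Convergence along a sequence $\epsilon=\epsilon_j\to0$. There is a continuous $h:\mathbb R\times[0,T_0]\to\mathbb R$, each $h(\cdot,t)$ a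 homeomorphism, $h(\alpha,0)=\alpha$, with $h^\epsilon\Rightarrow h$, $(h^\epsilon)^{-1}\Rightarrow h^{-1}$ on $\mathbb R\times[0,T_0]$, and $0<c_1\le\frac{h(\alpha,t)-h(\beta,t)}{\alpha-\beta}\le c_2<\infty$ for $\alpha\ne\beta$. There is a continuous $z:\mathbb R\times[0,T_0]\to\mathbb C$, twice continuously differentiable in $t$ with $z_t,z_{tt}$ bounded and continuous, and $z^\epsilon\Rightarrow z$, $z^\epsilon_t\Rightarrow z_t$, $z^\epsilon_{tt}\Rightarrow z_{tt}$. Put $Z=z\circ h^{-1}$, $Z_t=z_t\circ h^{-1}$, $Z_{tt}=z_{tt}\circ h^{-1}$; then $Z^\epsilon\Rightarrow Z$, $Z_t^\epsilon\Rightarrow Z_t$, $Z_{tt}^\epsilon\Rightarrow Z_{tt}$ on $\mathbb R\times[0,T_0]$, $Z(\alpha',t)=\Psi(\alpha',t)$ and $\overline{Z_t}(\alpha',t)=F(\alpha',t)$. On $\overline P_-\times[0,T_0]$: $\Psi^\epsilon\Rightarrow\Psi$, $\frac1{\Psi^\epsilon_{z'}}\Rightarrow\frac1{\Psi_{z'}}$, $\frac{\Psi^\epsilon_t}{\Psi^\epsilon_{z'}}\Rightarrow\frac{\Psi_t}{\Psi_{z'}}$, $F^\epsilon\Rightarrow F$, $\mathfrak P^\epsilon\Rightarrow\mathfrak P$. On $P_-\times[0,T_0]$: $\Psi^\epsilon_t\Rightarrow\Psi_t$, $\Psi^\epsilon_{z'}\Rightarrow\Psi_{z'}$, $F^\epsilon_{z'}\Rightarrow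 F_{z'}$, $F^\epsilon_t\Rightarrow F_t$, $(\partial_{x'}-i\partial_{y'})\mathfrak P^\epsilon\Rightarrow(\partial_{x'}-i\partial_{y'})\mathfrak P$. Finally $\mathfrak P=-\frac12|F|^2-y'+\frac12K_{y'}*(|Z_t|^2)$ on $P_-\times[0,T_0]$. *)

(* Defs.v *)
From HB Require Import structures.
From mathcomp Require Import all_boot all_order all_algebra.
From mathcomp Require Import all_classical all_reals all_analysis.
Set Implicit Arguments.
Unset Strict Implicit.
Unset Printing Implicit Defensive.
Import Order.TTheory GRing.Theory Num.Theory.
Import numFieldNormedType.Exports.
From mathcomp Require Import complex.
Import ComplexField.Normc.
Local Open Scope classical_set_scope.
Local Open Scope complex_scope.
Local Open Scope ring_scope.

(* The usual topology of the complex numbers: [R[i]] normed over itself. *)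
HB.instance Definition _ (R : realType) := NormedModule.copy R[i] R[i]^o.

Section Calculus.
Context {R : realType}.
Implicit Types (z w : R[i]) (t T : R).

Definition lhp : set R[i] := [set z | Im z < 0].
Definition clhp : set R[i] := [set z | Im z <= 0].
Definition slab (X : Type) (A : set X) T : set (X * R) := A `*` `[0, T].

(* Relative to a set [I], so that derivatives in time are one-sided at the
   endpoints of a time interval.  [deriv_on I g x] is only meaningful under
   [derivable_on I g x]. *)
Definition dquot (g : R -> R[i]) (x s : R) : R[i] := (g s - g x) / (s - x)%:C.
Definition derivable_on (I : set R) (g : R -> R[i]) (x : R) : Prop :=
  cvg (dquot g x s @[s --> within I x^']).
Definition deriv_on (I : set R) (g : R -> R[i]) (x : R) : R[i] :=
  lim (dquot g x s @[s --> within I x^']).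

Definition hor (f : R[i] -> R -> R[i]) z t : R -> R[i] :=
  fun s => f (s +i* Im z) t.
Definition ver (f : R[i] -> R -> R[i]) z t : R -> R[i] :=
  fun s => f (Re z +i* s) t.

Definition dx (f : R[i] -> R -> R[i]) z t : R[i] :=
  deriv_on [set: R] (hor f z t) (Re z).
Definition dy (f : R[i] -> R -> R[i]) z t : R[i] :=
  deriv_on [set: R] (ver f z t) (Im z).
Definition dt T (X : Type) (f : X -> R -> R[i]) (x : X) t : R[i] :=
  deriv_on `[0, T] (f x) t.
Definition da (f : R -> R -> R[i]) (a : R) t : R[i] :=
  deriv_on [set: R] (f^~ t) a.

Definition dxmidy (f : R[i] -> R -> R[i]) z t : R[i] :=
  dx f z t - 'i%C * dy f z t.
Definition dxpidy (f : R[i] -> R -> R[i]) z t : R[i] :=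
  dx f z t + 'i%C * dy f z t.
Definition dz (f : R[i] -> R -> R[i]) z t : R[i] := dxmidy f z t / 2%:R.

Definition cplx (X : Type) (f : X -> R -> R) (x : X) t : R[i] := (f x t)%:C.

(* Value on the closed half plane, through the continuous extension, of a
   function given on the open one. *)
Definition bv (f : R[i] -> R -> R[i]) z t : R[i] :=
  if Im z < 0 then f z t else lim (f w t @[w --> within lhp (nbhs z)]).
Definition onR (f : R[i] -> R -> R[i]) (a : R) t : R[i] := bv f a%:C t.

Definition cont_on (X Y : topologicalType) (A : set (X * R))
    (f : X -> R -> Y) : Prop :=
  {within A, continuous (fun p : X * R => f p.1 p.2)}.

(* [C] tells what continuity is required of the derivatives. *)
Fixpoint Ck_lhp (C : (R[i] -> R -> R[i]) -> Prop) T (k : nat)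
    (f : R[i] -> R -> R[i]) : Prop :=
  C f /\
  match k with
  | 0%N => True
  | k'.+1 =>
    (forall z t, lhp z -> t \in `[0, T] ->
       [/\ derivable_on [set: R] (hor f z t) (Re z),
           derivable_on [set: R] (ver f z t) (Im z)
         & derivable_on `[0, T] (f z) t]) /\
    [/\ Ck_lhp C T k' (dx f), Ck_lhp C T k' (dy f) & Ck_lhp C T k' (dt T f)]
  end.

Definition C1_lhp T (f : R[i] -> R -> R[i]) : Prop :=
  Ck_lhp (cont_on (slab lhp T)) T 1 f.

(* All the derivatives on the open half plane extend continuously to the
   closed one. *)
Definition smooth_clhp T (f : R[i] -> R -> R[i]) : Prop :=
  cont_on (slab clhp T) f /\
  forall k, Ck_lhp (fun g => cont_on (slab clhp T) (bv g)) T k f.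

Fixpoint Ck_line T (k : nat) (f : R -> R -> R[i]) : Prop :=
  cont_on (slab [set: R] T) f /\
  match k with
  | 0%N => True
  | k'.+1 =>
    (forall a t, t \in `[0, T] ->
       derivable_on [set: R] (f^~ t) a /\ derivable_on `[0, T] (f a) t) /\
    Ck_line T k' (da f) /\ Ck_line T k' (dt T f)
  end.

Definition holomorphic_lhp (f : R[i] -> R[i]) : Prop :=
  forall z, lhp z -> derivable f z 1.

Definition conformal_lhp (f : R[i] -> R -> R[i]) t : Prop :=
  holomorphic_lhp (f^~ t) /\ forall z, lhp z -> dz f z t != 0.

Definition tends_at_infty (f : R[i] -> R[i]) (l : R[i]) : Prop :=
  forall e : R, 0 < e ->
    exists M : R, forall z, lhp z -> M < normc z -> normc (f z - l) < e.

(* Boundary of an unbounded domain: a Jordan curve of the Riemann sphere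
   through infinity. *)
Definition jordan_curve (S : set R[i]) : Prop :=
  exists g : R -> R[i],
    [/\ continuous g, injective g,
        forall M : R, exists A : R, forall s, A < `|s| -> M < normc (g s)
      & range g = S].

Definition loc_unif_cvg (X : topologicalType) (Y : uniformType)
    (U : set (X * R)) (f : nat -> X -> R -> Y) (g : X -> R -> Y) : Prop :=
  {family [set K : set (X * R) | compact K /\ K `<=` U],
    (fun p : X * R => f n p.1 p.2) @[n --> \oo]
      --> (fun p : X * R => g p.1 p.2)}.

End Calculus.

Section Norms.
Context {R : realType}.

Definition trunc_fourier (f : R -> R[i]) (N xi : R) : R[i] :=
  let e x : R[i] := cos (x * xi) +i* - sin (x * xi) in
  ((Num.sqrt (2 * pi))^-1)%:C *
  ((\int[lebesgue_measure]_(x in `[- N, N]) Re (f x * e x)) +i*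
   (\int[lebesgue_measure]_(x in `[- N, N]) Im (f x * e x))).

Local Open Scope ereal_scope.

Definition normL (p : \bar R) (g : R -> R[i]) : \bar R :=
  Lnorm lebesgue_measure p (fun x : R => (normc (g x))%:E).

Definition measurable_cplx (g : R -> R[i]) : Prop :=
  measurable_fun [set: R] (fun x => Re (g x)) /\
  measurable_fun [set: R] (fun x => Im (g x)).

Definition normL_le (p : \bar R) (g : R -> R[i]) (C : R) : Prop :=
  normL p g <= C%:E.

(* Plancherel: [g] is the Fourier transform of [f] in [L^2]. *)
Definition is_fourier (f g : R -> R[i]) : Prop :=
  [/\ measurable_cplx f, measurable_cplx g,
      normL 2%:E f < +oo
    & normL 2%:E (fun xi => trunc_fourier f (N%:R)%R xi - g xi)%R
        @[N --> \oo] --> 0].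

(* The transform being unique almost everywhere, the infimum is over a single
   value when [f] is square integrable; otherwise it is [+oo]. *)
Definition normHhalf (f : R -> R[i]) : \bar R :=
  ereal_inf [set normL 2%:E (fun xi : R => (Num.sqrt `|xi|)%:C * g xi)%R
            | g in is_fourier f].

Definition slice (f : R[i] -> R -> R[i]) (t y : R) : R -> R[i] :=
  fun x => f (x +i* y) t.

Definition sup_slices (N : (R -> R[i]) -> \bar R)
    (f : R[i] -> R -> R[i]) (t : R) : \bar R :=
  ereal_sup [set N (slice f t y) | y in [set y : R | (y < 0)%R]].

Definition sup_slices2 (N : (R -> R[i]) -> \bar R)
    (f : R[i] -> R -> R[i]) (t : R) : \bar R :=
  ereal_sup [set N (slice f t y) ^+ 2 | y in [set y : R | (y < 0)%R]].

Definition energy1 (F Psi : R[i] -> R -> R[i]) (t : R) : \bar R :=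
  let V z t := ((dz Psi z t)^-1)%R in
  let D f z t := (V z t * dz f z t)%R in
  sup_slices2 (normL 2%:E) (dz F) t
  + sup_slices2 normHhalf (D F) t
  + sup_slices2 (normL 2%:E) (D (D F)) t
  + sup_slices2 normHhalf (fun z t => (V z t ^+ 2 * dz (D F) z t)%R) t
  + sup_slices2 (normL +oo) V t
  + sup_slices2 (normL 2%:E) (dz V) t
  + sup_slices2 (normL 2%:E) (D (D V)) t.

Definition lowsize (F Psi : R[i] -> R -> R[i]) (t : R) : \bar R :=
  sup_slices (normL 2%:E) F t
  + sup_slices (normL 2%:E) (fun z t => (dz Psi z t)^-1 - 1)%R t.

End Norms.

Section WaterWaves.
Context {R : realType}.
Implicit Types (F Psi : R[i] -> R -> R[i]) (P : R[i] -> R -> R)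
  (h hinv : R -> R -> R) (T : R).

Record water_wave T F Psi P : Prop := WaterWave {
  ww_eq : forall z t, lhp z -> t \in `[0, T] ->
    dt T F z t - dt T Psi z t * (dz F z t / dz Psi z t)
      + (F z t)^* * (dz F z t / dz Psi z t)
    = - ((dz Psi z t)^-1 * dxmidy (cplx P) z t) + 'i%C;
  ww_holo : forall t, t \in `[0, T] -> holomorphic_lhp (F^~ t);
  ww_conf : forall t, t \in `[0, T] -> conformal_lhp Psi t;
  ww_bdry : forall (a : R) t, t \in `[0, T] -> P a%:C t = 0;
  ww_real : forall (a : R) t, t \in `[0, T] -> exists b : R,
    (dz Psi z t)^-1 * ((F z t)^* - dt T Psi z t)
      @[z --> within lhp (nbhs a%:C)] --> b%:C;
  ww_infty : forall t, t \in `[0, T] ->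
    [/\ tends_at_infty (F^~ t) 0,
        tends_at_infty (fun z => dxmidy (cplx P) z t) 'i%C,
        tends_at_infty (fun z => dz Psi z t) 1
      & tends_at_infty (fun z => dt T Psi z t) 0] }.

Definition poisson (y x : R) : R := - y / (pi * (x ^+ 2 + y ^+ 2)).

Definition pressure_formula T F P : Prop :=
  forall z t, lhp z -> t \in `[0, T] ->
    P z t = - (normc (F z t) ^+ 2 / 2) - Im z
      + (\int[lebesgue_measure]_s
           (poisson (Im z) (Re z - s) * normc (F s%:C t) ^+ 2)) / 2.

Record initial_data T F Psi P : Prop := InitialData {
  id_F : holomorphic_lhp (F^~ 0);
  id_Psi : conformal_lhp Psi 0;
  id_inj : {in lhp &, injective (Psi^~ 0)};
  id_jordan : let Om := [set Psi z 0 | z in lhp] in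
    jordan_curve (closure Om `\` interior Om);
  id_infty : tends_at_infty (fun z => dz Psi z 0) 1;
  id_P_C2 : Ck_lhp (cont_on (slab lhp T)) T 2 (fun z _ => (P z 0)%:C);
  id_P_lap : forall z, lhp z ->
    dx (dx (cplx P)) z 0 + dy (dy (cplx P)) z 0
    = - (2 * normc (dz F z 0) ^+ 2)%:C;
  id_P_cont : {within clhp, continuous (P^~ 0)};
  id_P_bdry : forall a : R, P a%:C 0 = 0;
  id_P_infty : tends_at_infty (fun z => dxpidy (cplx P) z 0) (- 'i%C);
  id_energy : (energy1 F Psi 0 < +oo)%E;
  id_low : (lowsize F Psi 0 < +oo)%E }.

Record regular_solution T F Psi P : Prop := RegularSolution {
  rs_Psi_C1 : C1_lhp T Psi;
  rs_Psi_cont : cont_on (slab clhp T) Psi;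
  rs_invPsi_cont : cont_on (slab clhp T) (bv (fun z t => (dz Psi z t)^-1));
  rs_Psit_cont :
    cont_on (slab clhp T) (bv (fun z t => dt T Psi z t / dz Psi z t));
  rs_F_bound : exists M : R, forall z t, clhp z -> t \in `[0, T] ->
    normc (F z t) <= M;
  rs_F_cont : cont_on (slab clhp T) F;
  rs_F_C1 : C1_lhp T F;
  rs_P_cont : cont_on (slab clhp T) P;
  rs_P_C1 : C1_lhp T (cplx P);
  rs_energy : forall t, t \in `[0, T] -> (energy1 F Psi t < +oo)%E;
  rs_low : forall t, t \in `[0, T] -> (lowsize F Psi t < +oo)%E }.

(* Boundary quantities of a solution that is smooth up to the boundary. *)
Definition bZ Psi (a t : R) : R[i] := Psi a%:C t.
Definition bZa Psi : R -> R -> R[i] := da (bZ Psi).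
Definition bZt F (a t : R) : R[i] := (F a%:C t)^*.
Definition bb T F Psi : R -> R -> R[i] :=
  onR (fun z t => (dz Psi z t)^-1 * ((F z t)^* - dt T Psi z t)).
Definition lagr Psi h (a t : R) : R[i] := bZ Psi (h a t) t.
Definition bZtt T Psi h hinv (a t : R) : R[i] :=
  dt T (dt T (lagr Psi h)) (hinv a t) t.
Definition bA1 F (a t : R) : R :=
  1 + (2 * pi)^-1 * \int[lebesgue_measure]_b
        (normc (bZt F a t - bZt F b t) ^+ 2 / (a - b) ^+ 2).

Definition inverse_pair T h hinv : Prop := forall t, t \in `[0, T] ->
  cancel (h^~ t) (hinv^~ t) /\ cancel (hinv^~ t) (h^~ t).

Record smooth_approx T (F Psi : R[i] -> R -> R[i]) (eps : R)
    Fe Psie (Pe : R[i] -> R -> R) he heinv : Prop := SmoothApprox {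
  sa_sys : water_wave T Fe Psie Pe;
  sa_F_smooth : smooth_clhp T Fe;
  sa_Psi_smooth : smooth_clhp T Psie;
  sa_P_smooth : smooth_clhp T (cplx Pe);
  sa_F0 : forall z, clhp z -> Fe z 0 = F (z - 'i%C * eps%:C) 0;
  sa_Psi0 : forall z, clhp z -> Psie z 0 = Psi (z - 'i%C * eps%:C) 0;
  sa_h_smooth : forall k, Ck_line T k (cplx he);
  sa_h_inv : inverse_pair T he heinv;
  sa_h_flow : forall a t, t \in `[0, T] ->
    dt T (cplx he) a t = bb T Fe Psie (he a t) t;
  sa_h_init : forall a, he a 0 = a;
  sa_zt : forall a t, t \in `[0, T] ->
    dt T (lagr Psie he) a t = bZt Fe (he a t) t;
  sa_gradP : forall a t, t \in `[0, T] ->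
    onR (fun z t => (dz Psie z t)^-1 * dxmidy (cplx Pe) z t) a t
    = 'i%C * ((bA1 Fe a t)%:C / bZa Psie a t);
  sa_Ztt : forall a t, t \in `[0, T] ->
    (bZtt T Psie he heinv a t)^* - 'i%C
    = - 'i%C * ((bA1 Fe a t)%:C / bZa Psie a t);
  sa_P : pressure_formula T Fe Pe }.

(* [CE], [Cc], [c1] and [c2] stand for values of functions of the initial
   energy, and for [Cc] also of the size of the initial data. *)
Record uniform_bounds T (CE Cc c1 c2 : R) Fe Psie he : Prop := UniformBounds {
  ub_norms : forall t, t \in `[0, T] ->
    let V a t := (bZa Psie a t)^-1 in
    let Zta := da (bZt Fe) in
    let h := cplx he in
    let z := lagr Psie he in
    [/\ [/\ normL_le 2%:E (Zta^~ t) CE,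
            normL_le 2%:E (da V ^~ t) CE,
            normL_le +oo%E (fun a => (bA1 Fe a t)%:C) CE
          & normL_le 2%:E (fun a => V a t * da (cplx (bA1 Fe)) a t) CE],
        [/\ normL_le +oo%E (da (bb T Fe Psie) ^~ t) CE,
            normL_le +oo%E (fun a => da (dt T h) a t / da h a t) CE
          & normL_le +oo%E (fun a => da (dt T z) a t / da z a t) CE],
        normL_le 2%:E (da (fun a t => V a t ^+ 2 * Zta a t) ^~ t) CE /\
        normL_le 2%:E (da (fun a t => V a t ^+ 2 * (Zta a t)^*) ^~ t) CE
      & (normL +oo (bZt Fe ^~ t) + normL +oo (V^~ t) <= Cc%:E)%E];
  ub_points : forall a t, t \in `[0, T] ->
    let h := cplx he in
    let z := lagr Psie he in
    [/\ c1 <= normc (da h a t) <= c2,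
        c1 * normc (da z a 0) <= normc (da z a t) <= c2 * normc (da z a 0)
      & normc (da (dt T z) a t) <= c2 * normc (da z a 0)] }.

Record limit_flow T (c1 c2 : R) h hinv (z : R -> R -> R[i]) : Prop :=
    LimitFlow {
  lf_h_cont : cont_on (slab [set: R] T) h;
  lf_h_inv : inverse_pair T h hinv;
  lf_h_homeo : forall t, t \in `[0, T] ->
    continuous (h^~ t) /\ continuous (hinv^~ t);
  lf_h_init : forall a, h a 0 = a;
  lf_h_lip : forall a b t, a != b -> t \in `[0, T] ->
    c1 <= (h a t - h b t) / (a - b) <= c2;
  lf_z_cont : cont_on (slab [set: R] T) z;
  lf_z_dt : forall a t, t \in `[0, T] ->
    derivable_on `[0, T] (z a) t /\ derivable_on `[0, T] (dt T z a) t;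
  lf_zt_cont : cont_on (slab [set: R] T) (dt T z);
  lf_ztt_cont : cont_on (slab [set: R] T) (dt T (dt T z));
  lf_z_bound : exists M : R, forall a t, t \in `[0, T] ->
    normc (dt T z a t) <= M /\ normc (dt T (dt T z) a t) <= M }.

Record convergence T F Psi P h hinv (z : R -> R -> R[i])
    (Fn Psin : nat -> R[i] -> R -> R[i]) (Pn : nat -> R[i] -> R -> R)
    (hn hninv : nat -> R -> R -> R) : Prop := Convergence {
  cv_flow :
    let U := slab [set: R] T in
    [/\ loc_unif_cvg U hn h,
        loc_unif_cvg U hninv hinv,
        loc_unif_cvg U (fun n => lagr (Psin n) (hn n)) z,
        loc_unif_cvg U (fun n => dt T (lagr (Psin n) (hn n))) (dt T z)
      & loc_unif_cvg U (fun n => dt T (dt T (lagr (Psin n) (hn n))))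
          (dt T (dt T z))];
  cv_Z :
    let U := slab [set: R] T in
    [/\ loc_unif_cvg U (fun n => bZ (Psin n)) (fun a t => z (hinv a t) t),
        loc_unif_cvg U (fun n => bZt (Fn n)) (fun a t => dt T z (hinv a t) t)
      & loc_unif_cvg U (fun n => bZtt T (Psin n) (hn n) (hninv n))
          (fun a t => dt T (dt T z) (hinv a t) t)];
  cv_trace : forall a t, t \in `[0, T] ->
    z (hinv a t) t = Psi a%:C t /\ (dt T z (hinv a t) t)^* = F a%:C t;
  cv_closed :
    let U := slab clhp T in
    [/\ loc_unif_cvg U Psin Psi,
        loc_unif_cvg U (fun n => bv (fun z t => (dz (Psin n) z t)^-1))
          (bv (fun z t => (dz Psi z t)^-1)),
        loc_unif_cvg U
          (fun n => bv (fun z t => dt T (Psin n) z t / dz (Psin n) z t))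
          (bv (fun z t => dt T Psi z t / dz Psi z t)),
        loc_unif_cvg U Fn F
      & loc_unif_cvg U Pn P];
  cv_open :
    let U := slab lhp T in
    [/\ loc_unif_cvg U (fun n => dt T (Psin n)) (dt T Psi),
        loc_unif_cvg U (fun n => dz (Psin n)) (dz Psi),
        loc_unif_cvg U (fun n => dz (Fn n)) (dz F),
        loc_unif_cvg U (fun n => dt T (Fn n)) (dt T F)
      & loc_unif_cvg U (fun n => dxmidy (cplx (Pn n))) (dxmidy (cplx P))] }.

(* [CE], [c1], [c2] are functions of the initial energy and [Cc] is a function
   of the initial size and energy; they do not depend on the solution. *)
Definition wu_solution (CE : R -> R) (Cc : R -> R -> R) (c1 c2 : R -> R)
    T F Psi P h : Prop :=
  let E0 := fine (energy1 F Psi 0) in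
  let s0 := fine (lowsize F Psi 0) in
  [/\ 0 < c1 E0, 0 < c2 E0, initial_data T F Psi P,
      water_wave T F Psi P /\ regular_solution T F Psi P
    & exists (Fe Psie : R -> R[i] -> R -> R[i]) (Pe : R -> R[i] -> R -> R)
        (he heinv : R -> R -> R -> R),
      (forall eps : R, 0 < eps <= 1 ->
         smooth_approx T F Psi eps
           (Fe eps) (Psie eps) (Pe eps) (he eps) (heinv eps) /\
         uniform_bounds T (CE E0) (Cc s0 E0) (c1 E0) (c2 E0)
           (Fe eps) (Psie eps) (he eps)) /\
      exists (e : nat -> R) (hinv : R -> R -> R) (z : R -> R -> R[i]),
      [/\ (forall n, 0 < e n <= 1) /\ e n @[n --> \oo] --> (0 : R),
          limit_flow T (c1 E0) (c2 E0) h hinv z,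
          convergence T F Psi P h hinv z (Fe \o e) (Psie \o e) (Pe \o e)
            (he \o e) (heinv \o e)
        & pressure_formula T F P]].

Definition singular_set Psi (t : R) : set R :=
  [set a | onR (fun z t => (dz Psi z t)^-1) a t = 0].

End WaterWaves.

(* Main.v *)
Require Import Defs.
From mathcomp Require Import all_boot all_order all_algebra.
From mathcomp Require Import all_classical all_reals all_analysis.
From mathcomp Require Import ring lra.
Import Order.TTheory GRing.Theory Num.Theory.
Import numFieldNormedType.Exports.
From mathcomp Require Import complex.
Import ComplexField.Normc.
Set Implicit Arguments.
Unset Strict Implicit.
Unset Printing Implicit Defensive.
Local Open Scope classical_set_scope.
Local Open Scope complex_scope.
Local Open Scope ring_scope.

(* For the smooth approximations, differentiating z = Z o h in the label gives
   z_a = Z_{,a'}(h) h_a.  The uniform two-sided bounds on |h_a| and on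
   |z_a(a,t)| / |z_a(a,0)| then make |1/Z_{,a'}|(h(a,t),t) and
   |1/Z_{,a'}|(a,0) comparable, with constant c2/c1 independent of the
   approximation; this passes to the limit.  No approximation is singular at
   time 0, where its boundary is the image of a horizontal line inside P_-. *)

Section BoundaryDerivatives.
Context {R : realType}.
Implicit Types (z w l : R[i]) (g : R -> R[i]) (f Psi : R[i] -> R -> R[i]).

(** * Real-valued modulus and neighborhoods in the complex plane *)

Lemma ler_normcD z w : normc (z + w) <= normc z + normc w.
Proof. exact: le_normcD. Qed.

Lemma normc_distC z w : normc (z - w) = normc (w - z).
Proof. by rewrite -[LHS]normcN opprB. Qed.

Lemma normc_real (x : R) : normc x%:C = `|x|.
Proof. by rewrite /= expr0n addr0 sqrtr_sqr. Qed.

Lemma normc_imag (x : R) : normc ('i%C * x%:C) = `|x|.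
Proof.
by rewrite normcM normc_real /= expr0n expr1n add0r sqrtr1 mul1r.
Qed.

Lemma Re_le_normc z : `|Re z| <= normc z.
Proof.
case: z => x y /=; rewrite -sqrtr_sqr ler_wsqrtr// lerDl; exact: sqr_ge0.
Qed.

Lemma Im_le_normc z : `|Im z| <= normc z.
Proof.
case: z => x y /=; rewrite -sqrtr_sqr ler_wsqrtr// lerDr; exact: sqr_ge0.
Qed.

Lemma normc_le_ReIm z : normc z <= `|Re z| + `|Im z|.
Proof.
case: z => x y /=.
rewrite -[leRHS]ger0_norm ?addr_ge0// -[leRHS]sqrtr_sqr ler_wsqrtr//.
by rewrite sqrrD !real_normK ?num_real// lerD2r lerDl mulrn_wge0// mulr_ge0.
Qed.

Lemma Re_BM_real z w l (x : R) : Re (z - w - l * x%:C) = Re z - Re w - Re l * x.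
Proof. by case: z w l => [? ?] [? ?] [? ?] /=; rewrite mulr0 subr0. Qed.

Lemma Im_BM_real z w l (x : R) : Im (z - w - l * x%:C) = Im z - Im w - Im l * x.
Proof. by case: z w l => [? ?] [? ?] [? ?] /=; rewrite mulr0 add0r. Qed.

Lemma normc_ge0 z : 0 <= normc z.
Proof. by case: z => x y /=; exact: sqrtr_ge0. Qed.

Lemma normc_eq0 z : (normc z == 0) = (z == 0).
Proof. by apply/eqP/eqP => [/eq0_normc//|->]; exact: normc0. Qed.

Lemma normc_gt0 z : (0 < normc z) = (z != 0).
Proof. by rewrite lt_neqAle normc_ge0 andbT eq_sym normc_eq0. Qed.

Lemma ltc_norm z (e : R) : (`|z| < e%:C) = (normc z < e).
Proof. exact: ltcR. Qed.

(** The order of [R[i]] compares only numbers with equal imaginary parts, so a positive radius is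
    real. This turns the complex radii of balls into real ones. *)
Lemma gtc0_complexP (e : R[i]) : 0 < e -> exists2 r : R, 0 < r & e = r%:C.
Proof. by case: e => x y; rewrite ltcE /= => /andP[/eqP -> x0]; exists x. Qed.

Lemma cvgcP (X : Type) (F : set_system X) (f : X -> R[i]) (l : R[i]) :
  Filter F ->
  (f x @[x --> F] --> l) <->
  (forall e : R, 0 < e -> \forall x \near F, normc (f x - l) < e).
Proof.
move=> FF; split => [/cvgrPdist_lt H e e0|H].
  have /H : (0 : R[i]) < e%:C by rewrite ltcR.
  by apply: filterS => x; rewrite normc_distC -ltc_norm.
apply/cvgrPdist_lt => _ /gtc0_complexP[e e0 ->].
by apply: filterS (H _ e0) => x; rewrite normc_distC -ltc_norm.
Qed.

Lemma nbhs_normcP (a : R[i]) (A : set R[i]) :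
  nbhs a A <-> exists2 e : R, 0 < e & forall z, normc (z - a) < e -> A z.
Proof.
split.
  move/nbhs_ballP => [_ /gtc0_complexP[e e0 ->]] H; exists e => // z ze.
  apply: H.
  by rewrite -ball_normE; move: ze; rewrite normc_distC -ltc_norm.
move=> [e e0 H]; apply/nbhs_ballP; exists e%:C => /=.
  by rewrite ltcR.
by move=> z; rewrite -ball_normE => ze; apply: H; rewrite normc_distC -ltc_norm.
Qed.

Lemma within_normcP (D : set R[i]) (a : R[i]) (A : set R[i]) :
  within D (nbhs a) A <->
  exists2 e : R, 0 < e & forall z, D z -> normc (z - a) < e -> A z.
Proof.
split=> [/nbhs_normcP[e e0 H]|[e e0 H]].
  by exists e => // z Dz za; exact: H.
by apply/nbhs_normcP; exists e => // z za Dz; exact: H.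
Qed.

(** * Difference quotients on the line, mean value bound and chain rule *)

Lemma dnbhs_distP (a : R) (A : set R) :
  (within [set: R] a^' A) <->
  exists2 e : R, 0 < e & forall s, `|s - a| < e -> s != a -> A s.
Proof.
split.
  move/nbhs_ballP => [e /= e0 H]; exists e => // s sa sna.
  by apply: H => //; rewrite -ball_normE /= distrC.
move=> [e e0 H]; apply/nbhs_ballP; exists e => //= s.
by rewrite -ball_normE /= distrC => sa sna _; exact: H.
Qed.

(** Clearing the denominator gives a condition that is also meaningful at [s = x]. The chain rule
    needs this, since the inner function may take the value [k x] at other points. *)
Lemma dquotP g (x : R) l :
  dquot g x s @[s --> within [set: R] x^'] --> l <->
  forall e : R, 0 < e -> exists2 d : R, 0 < d & forall s, `|s - x| < d ->
    normc (g s - g x - l * (s - x)%:C) <= e * `|s - x|.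
Proof.
have key s e : s != x ->
    (normc (dquot g x s - l) <= e) =
    (normc (g s - g x - l * (s - x)%:C) <= e * `|s - x|).
  move=> sx; have sx0 : (s - x)%:C != 0 :> R[i].
    by rewrite -normc_eq0 normc_real normr_eq0 subr_eq0.
  have -> : g s - g x - l * (s - x)%:C = (dquot g x s - l) * (s - x)%:C.
    by rewrite mulrBl /dquot divfK.
  by rewrite normcM normc_real ler_pM2r// normr_gt0 subr_eq0.
split=> [/cvgcP H e e0|H].
  have /dnbhs_distP[d d0 Hd] := H _ e0; exists d => // s sd.
  have [->|sx] := eqVneq s x.
    by rewrite !subrr normr0 mulr0 mulr0 subr0 normc0.
  by rewrite -key// ltW// Hd.
apply/cvgcP => e e0; have [|d d0 Hd] := H (e / 2); first by rewrite divr_gt0.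
apply/dnbhs_distP; exists d => // s sd sx.
by apply: le_lt_trans (_ : _ <= e / 2) _; [rewrite key//; exact: Hd | lra].
Qed.

Lemma is_derive_dist (f : R -> R) (x d : R) :
  (forall e : R, 0 < e -> exists2 r : R, 0 < r & forall s, `|s - x| < r ->
    `|f s - f x - d * (s - x)| <= e * `|s - x|) ->
  is_derive x 1 f d.
Proof.
move=> H.
suff hf : h^-1 *: ((f \o shift x) (h *: 1) - f x) @[h --> 0^'] --> d.
  by apply: DeriveDef; [exact: cvgP hf | exact: cvg_lim hf].
apply/cvgrPdist_le => e e0; have [r r0 Hr] := H _ e0.
apply/nbhs_ballP; exists r => //= s.
rewrite -ball_normE /= sub0r normrN => sr s0.
have := Hr (s + x); rewrite addrK => /(_ sr).
have -> : d - s^-1 *: (f (s *: 1 + x) - f x) = - (f (s + x) - f x - d * s) / s.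
  by rewrite /GRing.scale /= mulr1; field.
by rewrite normrM normrN normfV ler_pdivrMr ?normr_gt0.
Qed.

(** The mean value theorem fails for complex values, so it is applied to the real and imaginary
    parts separately. The two intermediate points may differ, which costs the factor 2. *)
Lemma mean_value_dist g l (e x y : R) :
  (forall s, derivable_on [set: R] g s) ->
  (forall s, x <= s <= y -> normc (deriv_on [set: R] g s - l) <= e) ->
  x <= y -> normc (g y - g x - l * (y - x)%:C) <= 2 * e * (y - x).
Proof.
move=> dg le xy.
have Re_der (s : R) :
    is_derive s 1 (fun u : R => Re (g u)) (Re (deriv_on [set: R] g s)).
  apply: is_derive_dist => r r0.
  have /dquotP/(_ _ r0)[d d0 Hd] := dg s; exists d => // u ud.
  by rewrite -Re_BM_real; exact: le_trans (Re_le_normc _) (Hd u ud).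
have Im_der (s : R) :
    is_derive s 1 (fun u : R => Im (g u)) (Im (deriv_on [set: R] g s)).
  apply: is_derive_dist => r r0.
  have /dquotP/(_ _ r0)[d d0 Hd] := dg s; exists d => // u ud.
  by rewrite -Im_BM_real; exact: le_trans (Im_le_normc _) (Hd u ud).
have cont (f df : R -> R) : (forall s : R, is_derive s 1 f (df s)) ->
    {within `[x, y], continuous f}.
  move=> fdf; apply: continuous_subspaceT => s.
  by apply: differentiable_continuous; apply/derivable1_diffP; have [] := fdf s.
have yx0 : 0 <= y - x by rewrite subr_ge0.
have [c cxy Ec] := MVT_segment xy (fun s _ => Re_der s) (cont _ _ Re_der).
have [c' cxy' Ec'] := MVT_segment xy (fun s _ => Im_der s) (cont _ _ Im_der).
apply: le_trans (normc_le_ReIm _) _.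
rewrite Re_BM_real Im_BM_real Ec Ec' -!mulrBl.
rewrite !normrM (ger0_norm yx0) -mulrDl ler_wpM2r// mulr2n mulrDl mul1r lerD//.
  rewrite -raddfB; apply: le_trans (Re_le_normc _) (le _ _).
  by move: cxy; rewrite in_itv.
rewrite -raddfB; apply: le_trans (Im_le_normc _) (le _ _).
by move: cxy'; rewrite in_itv.
Qed.

Lemma deriv_onE g (x : R) l :
  dquot g x s @[s --> within [set: R] x^'] --> l -> deriv_on [set: R] g x = l.
Proof.
rewrite /deriv_on withinET => H; apply: cvg_lim H; exact: norm_hausdorff.
Qed.

Lemma dquot_comp g (k : R -> R) (x : R) l (d : R[i]) :
  dquot g (k x) s @[s --> within [set: R] (k x)^'] --> l ->
  dquot (fun s => (k s)%:C) x s @[s --> within [set: R] x^'] --> d ->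
  dquot (g \o k) x s @[s --> within [set: R] x^'] --> l * d.
Proof.
move=> /dquotP gl /dquotP kd; apply/dquotP => e e0.
have N0 : 0 < normc l + 1 by have := normc_ge0 l; lra.
have e10 : 0 < e / (2 * (normc l + 1)) by rewrite divr_gt0// mulr_gt0.
(* The error of the inner function gets multiplied by [l]; this [e1] keeps the product below half of
   [e]. The added 1 covers the case [l = 0]. *)
set e1 := e / _ in e10; have e1l : e1 * normc l <= e / 2.
  rewrite /e1 invfM mulrA -mulrA ler_piMr//; first lra.
  by rewrite mulrC ler_pdivrMr// mul1r; lra.
have M0 : 0 < normc d + e1 by have := normc_ge0 d; lra.
(* Near [x] the inner function moves by at most [normc d + e1] times [|s - x|]. Dividing by this
   factor makes the outer error at most [e / 2 * |s - x|]. *)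
have [|r2 r20 H2] := gl (e / (2 * (normc d + e1))).
  by rewrite divr_gt0// mulr_gt0.
have [r1 r10 H1] := kd _ e10.
exists (Num.min r1 (r2 / (normc d + e1))).
  by rewrite lt_min r10 divr_gt0.
move=> s; rewrite lt_min ltr_pdivlMr// => /andP[sr1 sr2].
have {}H1 := H1 _ sr1.
have kB : `|k s - k x| <= (normc d + e1) * `|s - x|.
  have := ler_normcD ((k s)%:C - (k x)%:C - d * (s - x)%:C) (d * (s - x)%:C).
  rewrite subrK -rmorphB normcM !normc_real.
  by move: H1; rewrite -rmorphB; lra.
have {}H2 := H2 (k s) (le_lt_trans kB (_ : _ < r2)).
have {}H2 : normc (g (k s) - g (k x) - l * (k s - k x)%:C) <= e / 2 * `|s - x|.
  apply: le_trans (H2 _) _; first by rewrite mulrC.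
  apply: le_trans (ler_wpM2l _ kB) _.
    by rewrite ltW// divr_gt0// mulr_gt0.
  by rewrite mulrA ler_wpM2r// le_eqVlt; apply/orP; left; apply/eqP; field; lra.
have -> : (g \o k) s - (g \o k) x - l * d * (s - x)%:C =
    (g (k s) - g (k x) - l * (k s - k x)%:C) +
    l * ((k s)%:C - (k x)%:C - d * (s - x)%:C).
  by rewrite /= [(k s - k x)%:C]rmorphB; ring.
apply: le_trans (ler_normcD _ _) _; rewrite normcM.
have : normc l * normc ((k s)%:C - (k x)%:C - d * (s - x)%:C) <=
    e / 2 * `|s - x|.
  apply: le_trans (ler_wpM2l (normc_ge0 _) H1) _.
  by rewrite mulrCA mulrA ler_wpM2r.
by move: H2; lra.
Qed.

(** * Holomorphic functions and their horizontal derivatives at the boundary *)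

Lemma holomorphic_dquot f t (z : R[i]) : derivable (f^~ t) z 1 ->
  exists D : R[i],
  dquot (hor f z t) (Re z) s @[s --> within [set: R] (Re z)^'] --> D /\
  dquot (ver f z t) (Im z) s @[s --> within [set: R] (Im z)^'] --> 'i%C * D.
Proof.
move=> /cvg_ex[D /cvgcP HD]; exists D.
have {}HD e : 0 < e -> exists2 d : R, 0 < d & forall w, normc w < d ->
    normc (f (z + w) t - f z t - D * w) <= e * normc w.
  move=> e0; have /within_normcP[d d0 Hd] := HD _ e0; exists d => // w wd.
  have [->|w0] := eqVneq w 0.
    by rewrite addr0 !subrr mulr0 normc0 mulr0 subr0 normc0.
  have := Hd w w0; rewrite subr0 => /(_ wd) /ltW.
  rewrite /= /GRing.scale /= mulr1 [w + z]addrC.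
  have -> : f (z + w) t - f z t - D * w =
      (w^-1 * (f (z + w) t - f z t) - D) * w.
    by field.
  by rewrite normcM ler_pM2r// normc_gt0.
have Ez : z = Re z +i* Im z by case: z {HD}.
split; apply/dquotP => e e0; have [d d0 Hd] := HD e e0; exists d => // s sd.
  have := Hd (s - Re z)%:C; rewrite normc_real => /(_ sd).
  congr (normc (f _ t - f _ t - _) <= _) => //.
  apply/eqP; rewrite {1}Ez eq_complex /=.
  by apply/andP; split; apply/eqP; ring.
have := Hd ('i%C * (s - Im z)%:C); rewrite normc_imag => /(_ sd).
congr (normc (f _ t - f _ t - _) <= _) => //; last by ring.
apply/eqP; rewrite {1}Ez eq_complex /=.
by apply/andP; split; apply/eqP; ring.
Qed.

(** By the Cauchy-Riemann equations the two partial derivatives are [D] and [i D], and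
    [(D - i (i D)) / 2 = D]. *)
Lemma holomorphic_dz f t (z : R[i]) : derivable (f^~ t) z 1 ->
  dz f z t = dx f z t /\ derivable_on [set: R] (hor f z t) (Re z).
Proof.
move=> /holomorphic_dquot[D [/[dup] hD /deriv_onE Dx /deriv_onE Dy]]; split.
  rewrite /dz /dxmidy /dy Dy /dx Dx mulrA -expr2 sqr_i mulN1r opprK.
  by field.
exact: cvgP hD.
Qed.

(** The mean value bound holds on horizontal segments just below the boundary, where [dx f] is close
    to [l]. Continuity up to the boundary carries it to the real line as the segment rises. *)
Lemma dquot_boundary f t (a : R) l :
  (forall s : R, f w t @[w --> within lhp (nbhs s%:C)] --> f s%:C t) ->
  (forall z, lhp z -> derivable_on [set: R] (hor f z t) (Re z)) ->
  dx f w t @[w --> within lhp (nbhs a%:C)] --> l ->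
  dquot (fun s => f s%:C t) a s @[s --> within [set: R] a^'] --> l.
Proof.
move=> fcont fder /cvgcP fl; apply/dquotP => e e0.
have [|d d0 Hd] := (within_normcP _ _ _).1 (fl (e / 2) _); first lra.
exists (d / 2) => [|s sd]; first lra.
(* The slack [r] pays for replacing the boundary values at [s] and [a] by values at depth [y], half
   of it at each end. The depth may depend on [r] and [s], while [d] does not. *)
apply/ler_addgt0Pr => r r0; have r20 : 0 < r / 2 by rewrite divr_gt0.
have /cvgcP/(_ _ r20)/within_normcP[r1 r1_gt0 H1] := fcont s.
have /cvgcP/(_ _ r20)/within_normcP[r2 r2_gt0 H2] := fcont a.
(* A segment of length below [d / 2] at depth at most [d / 4] stays within [d] of [a]. Taking
   [y = m / 2] also keeps the depth strictly below [r1] and [r2]. *)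
pose m := Num.min (d / 2) (Num.min r1 r2).
have m0 : 0 < m by rewrite !lt_min r1_gt0 r2_gt0 divr_gt0.
have md : m <= d / 2 by rewrite ge_min lexx.
have mr1 : m <= r1 by rewrite !ge_min lexx orbT.
have mr2 : m <= r2 by rewrite !ge_min lexx !orbT.
pose y := m / 2; pose g := hor f (a +i* - y) t.
have y0 : 0 < y by rewrite /y; lra.
have lhpy u : lhp (u +i* - y) by rewrite /lhp /= oppr_lt0.
have distE (u : R) : normc (u +i* - y - u%:C) = y.
  have -> : u +i* - y - u%:C = - ('i%C * y%:C).
    by apply/eqP; rewrite eq_complex /=; apply/andP; split; apply/eqP; ring.
  by rewrite normcN normc_imag gtr0_norm.
have gder u : derivable_on [set: R] g u by exact: fder (lhpy u).
have gd u : `|u - a| < d / 2 -> normc (deriv_on [set: R] g u - l) <= e / 2.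
  move=> ua; apply/ltW/(Hd _ (lhpy u)).
  have -> : u +i* - y - a%:C = (u +i* - y - u%:C) + (u - a)%:C.
    by rewrite rmorphB; ring.
  by apply: le_lt_trans (ler_normcD _ _) _; rewrite distE normc_real /y; lra.
have gs : normc (g s - g a - l * (s - a)%:C) <= e * `|s - a|.
  have [as_|sa] := leP a s.
    have := mean_value_dist (e := e / 2) gder _ as_.
    rewrite mulrCA mulfV// mulr1 (ger0_norm (_ : 0 <= s - a)) ?subr_ge0//.
    by apply=> u /andP[? ?]; apply: gd; move: sd; rewrite !ger0_norm; lra.
  have := mean_value_dist (e := e / 2) gder _ (ltW sa).
  rewrite mulrCA mulfV// mulr1 distrC (gtr0_norm (_ : 0 < a - s)) ?subr_gt0//.
  have -> : g s - g a - l * (s - a)%:C = - (g a - g s - l * (a - s)%:C).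
    by rewrite !rmorphB; ring.
  rewrite normcN; apply=> u /andP[? ?]; apply: gd.
  by move: sd; rewrite !ler0_norm; lra.
have {}H1 : normc (f s%:C t - g s) < r / 2.
  by rewrite normc_distC; apply: H1 => //; rewrite distE /y; lra.
have {}H2 : normc (g a - f a%:C t) < r / 2.
  by apply: H2 => //; rewrite distE /y; lra.
have -> : f s%:C t - f a%:C t - l * (s - a)%:C = (f s%:C t - g s) +
   ((g s - g a - l * (s - a)%:C) + (g a - f a%:C t)) by ring.
apply: le_trans (ler_normcD _ _) _.
have := ler_normcD (g s - g a - l * (s - a)%:C) (g a - f a%:C t).
lra.
Qed.

(** * Traces on the real line *)

Lemma lim_cplx (X : Type) (F : set_system X) (FF : ProperFilter F)
    (f : X -> R[i]) l :
  f x @[x --> F] --> l -> lim (f x @[x --> F]) = l.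
Proof. by move=> H; apply: cvg_lim H; exact: norm_hausdorff. Qed.

Lemma lhp_nbhs_proper (a : R) : ProperFilter (within lhp (nbhs (a%:C : R[i]))).
Proof.
apply: within_nbhs_proper => B /nbhs_normcP[e e0 He].
exists (a +i* - (e / 2)); split; first by rewrite /lhp /= oppr_lt0 divr_gt0.
apply: He; have -> : a +i* - (e / 2) - a%:C = - ('i%C * (e / 2)%:C).
  by apply/eqP; rewrite eq_complex /=; apply/andP; split; apply/eqP; ring.
by rewrite normcN normc_imag gtr0_norm; lra.
Qed.

Lemma cont_on_slice (D E : set R[i]) (T t : R) f (a : R[i]) :
  cont_on (slab D T) f -> t \in `[0, T] -> D a -> E `<=` D ->
  f w t @[w --> within E (nbhs a)] --> f a t.
Proof.
move=> /subspace_continuousP fc tT Da ED.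
have pa : slab D T (a, t) by split.
apply: (@cvg_comp _ _ _ (pair^~ t) (fun p => f p.1 p.2) _ _ _ _ (fc _ pa)).
move=> B; rewrite /= !nbhs_simpl /= => HB.
have tc : (fun=> t) w @[w --> nbhs a] --> t by exact: cvg_cst.
have ac : id w @[w --> nbhs a] --> a by exact: cvg_id.
have fa := nbhs_filter a; have ft := nbhs_filter t.
have H := @cvg_pair _ _ _ _ _ _ fa fa ft _ _ ac tc _ HB.
by apply: (@filterS _ _ fa _ _ _ H) => w Bw /ED Dw; exact: Bw.
Qed.

Lemma onR_lim f (a t : R) :
  onR f a t = lim (f w t @[w --> within lhp (nbhs a%:C)]).
Proof. by rewrite /onR /bv ltxx. Qed.

(** By smoothness [dx f] extends continuously to the boundary, so its trace is the tangential
    derivative [bZa]. Below the boundary [dz] equals [dx], and inversion commutes with the limit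
    where that limit is nonzero. *)
Lemma onR_inv_dz T f (a t : R) : smooth_clhp T f -> t \in `[0, T] ->
  holomorphic_lhp (f^~ t) ->
  dquot (bZ f ^~ t) a s @[s --> within [set: R] a^'] --> bZa f a t /\
  (bZa f a t != 0 -> onR (fun z t => (dz f z t)^-1) a t = (bZa f a t)^-1).
Proof.
move=> [fc fs] tT fholo.
have lhpS : lhp `<=` (@clhp R) by move=> z; exact: ltW.
have real_clhp (s : R) : clhp (s%:C : R[i]) by exact: lexx.
have within_lhp (g : R[i] -> R -> R[i]) (s : R) : cont_on (slab clhp T) g ->
    g w t @[w --> within lhp (nbhs s%:C)] --> g s%:C t.
  by move=> gc; exact: cont_on_slice gc tT (real_clhp s) lhpS.
have [_ [_ [[dxc _] _ _]]] := fs 1.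
have dxl : dx f w t @[w --> within lhp (nbhs a%:C)] --> bv (dx f) a%:C t.
  move: (within_lhp _ a dxc); apply: cvg_trans.
  by apply: fmap_within_eq => w; rewrite inE /lhp /bv /= => ->.
have dq : dquot (bZ f ^~ t) a s @[s --> within [set: R] a^']
    --> bv (dx f) a%:C t.
  apply: dquot_boundary dxl; first by move=> s; exact: within_lhp.
  by move=> z /fholo/holomorphic_dz[].
have E : bZa f a t = bv (dx f) a%:C t by exact: deriv_onE dq.
rewrite E; split=> // l0.
rewrite onR_lim.
have iv : (dz f w t)^-1 @[w --> within lhp (nbhs a%:C)]
    --> (bv (dx f) a%:C t)^-1.
  apply: cvgV => //; move: dxl; apply: cvg_trans.
  by apply: fmap_within_eq => w; rewrite inE => /fholo/holomorphic_dz[->].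
exact: (lim_cplx (lhp_nbhs_proper a)).
Qed.

Lemma approx_inv_dz_comparable T F Psi eps Fe Psie Pe he heinv CE Cc
    (c1 c2 : R) a t :
  0 < c1 -> 0 < c2 -> 0 < eps -> conformal_lhp Psi 0 ->
  smooth_approx T F Psi eps Fe Psie Pe he heinv ->
  uniform_bounds T CE Cc c1 c2 Fe Psie he -> t \in `[0, T] ->
  let V := onR (fun z t => (dz Psie z t)^-1) in
  normc (V (he a t) t) <= c2 / c1 * normc (V a 0) /\
  normc (V a 0) <= c2 / c1 * normc (V (he a t) t).
Proof.
move=> c10 c20 eps0 [Psi_holo Psi_dz] sa ub tT V.
have T0 : 0 <= T by move: tT; rewrite in_itv /= => /andP[]; exact: le_trans.
have T00 : 0 \in `[0, T] by rewrite in_itv /= lexx.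
have holo s : s \in `[0, T] -> holomorphic_lhp (Psie^~ s).
  by move=> sT; have [] := ww_conf (sa_sys sa) sT.
have key := onR_inv_dz _ (sa_Psi_smooth sa) _ (holo _ _).
(* At time 0 the boundary point [a] corresponds to the point [a - i eps] for [Psi]. It lies in the
   open half plane, where conformality excludes a zero derivative. *)
have Za0 : bZa Psie a 0 != 0.
  have lz : lhp (a +i* - eps) by rewrite /lhp /= oppr_lt0.
  have [dzE _] := holomorphic_dz (Psi_holo _ lz).
  have := Psi_dz _ lz; rewrite dzE; congr (deriv_on _ _ _ != 0).
  apply/funext => s; rewrite /bZ (sa_Psi0 sa); last exact: lexx.
  by rewrite /hor /=; congr (Psi _ 0); apply/eqP; rewrite eq_complex /=;
     apply/andP; split; apply/eqP; ring.
have zaE s : s \in `[0, T] ->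
    da (lagr Psie he) a s = bZa Psie (he a s) s * da (cplx he) a s.
  move=> sT; have [_ [/(_ a s sT)[hd _] _]] := sa_h_smooth sa 1.
  exact/deriv_onE/(dquot_comp (key _ _ sT sT).1 hd).
have za0 : da (lagr Psie he) a 0 = bZa Psie a 0.
  congr (deriv_on _ _ _); apply/funext => s.
  by rewrite /lagr (sa_h_init sa).
have [/andP[h1 h2] + _] := ub_points ub a tT.
rewrite za0 zaE// normcM => /andP[z1 z2].
have Z0 : 0 < normc (bZa Psie a 0) by rewrite normc_gt0.
(* A zero here would make the middle term of [z1] vanish, although its lower bound is positive. *)
have Zt : 0 < normc (bZa Psie (he a t) t).
  rewrite lt_neqAle normc_ge0 andbT eq_sym; apply: contraTneq z1 => ->.
  by rewrite mul0r -ltNge mulr_gt0.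
have Zt0 : bZa Psie (he a t) t != 0 by rewrite -normc_gt0.
have V0E : normc (V a 0) = (normc (bZa Psie a 0))^-1.
  by rewrite -normcV; congr normc; exact: (key a 0 T00 T00).2 Za0.
have VtE : normc (V (he a t) t) = (normc (bZa Psie (he a t) t))^-1.
  by rewrite -normcV; congr normc; exact: (key _ _ tT tT).2 Zt0.
clearbody V; rewrite V0E VtE.
move: Z0 Zt h1 h2 z1 z2; move: (normc _) (normc _) (normc _) => x y k.
move=> x0 y0 c1k kc2 z1 z2.
(* Both comparisons are instances of this, with the roles of [u] and [v] exchanged. The bounds on
   the derivative of [he] turn [z1] and [z2] into the required premises. *)
have inv_le (u v : R) : 0 < u -> 0 < v -> c1 * u <= c2 * v ->
    v^-1 <= c2 / c1 * u^-1.
  move=> u0 v0 uv; rewrite -mulrA -invfM ler_pdivlMr ?mulr_gt0//.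
  by rewrite mulrC ler_pdivrMr.
split; apply: inv_le => //.
  by apply: le_trans z1 _; rewrite mulrC ler_wpM2r// ltW.
by apply: le_trans z2; rewrite mulrC ler_wpM2l// ltW.
Qed.

(** * Passage to the limit along the approximations *)

Lemma loc_unif_cvg_compact (X : topologicalType) (K0 : numDomainType)
    (Y : pseudoMetricType K0) (U K : set (X * R)) (h : nat -> X -> R -> Y) k :
  loc_unif_cvg U h k -> compact K -> K `<=` U -> forall e : K0, 0 < e ->
  \forall n \near \oo, forall p, K p -> ball (k p.1 p.2) e (h n p.1 p.2).
Proof.
move=> /fam_cvgP H Kc KU e e0.
apply: (H K (conj Kc KU) [set q | forall p, K p -> ball (k p.1 p.2) e (q p)]).
apply/uniform_nbhs; exists [set xy | ball xy.1 e xy.2]; split=> //.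
exact: (entourage_ball Y (PosNum e0)).
Qed.

Lemma compact_real_slice (x0 t : R) :
  compact ((fun x : R => (x%:C, t) : R[i] * R) @` `[x0 - 1, x0 + 1]).
Proof.
apply: continuous_compact; last exact: segment_compact.
apply: continuous_subspaceT => x A.
have xc : u%:C @[u --> x] --> (x%:C : R[i]).
  apply/cvgcP => e e0; apply/nbhs_ballP; exists e => // u xu.
  by rewrite -rmorphB normc_real distrC; exact: xu.
have tc : (fun=> t) u @[u --> x] --> t by exact: cvg_cst.
have fx := nbhs_filter x; have fxc := nbhs_filter (x%:C : R[i]).
exact: (@cvg_pair _ _ _ _ _ _ fx fxc (nbhs_filter t) _ _ xc tc).
Qed.

(** Needed because [1/Psi_z'] of the approximation is evaluated at [he (e n) a t], which moves with
    [n]. Uniform convergence on a segment around [x0] replaces [fn n] by [f], and continuity of [f]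
    then replaces [x n] by [x0]. *)
Lemma loc_unif_cvg_moving (T t x0 : R) (x : nat -> R)
    (fn : nat -> R[i] -> R -> R[i]) f :
  loc_unif_cvg (slab clhp T) fn f -> cont_on (slab clhp T) f -> t \in `[0, T] ->
  x n @[n --> \oo] --> x0 -> fn n (x n)%:C t @[n --> \oo] --> f x0%:C t.
Proof.
move=> fnf fc tT xx0; apply/cvgcP => e e0.
have e20 : 0 < e / 2 by rewrite divr_gt0.
have real_clhp (s : R) : clhp (s%:C : R[i]) by exact: lexx.
have /cvgcP/(_ _ e20)/within_normcP[d d0 Hd] :=
  cont_on_slice fc tT (real_clhp x0) (@subset_refl _ _).
set K := ((fun x : R => (x%:C, t) : R[i] * R) @` `[x0 - 1, x0 + 1]).
have KU : K `<=` slab clhp T by move=> _ [s _ <-]; split; [exact: real_clhp|].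
have e2c : 0 < (e / 2)%:C :> R[i] by rewrite ltcR.
have H := loc_unif_cvg_compact fnf (@compact_real_slice x0 t) KU e2c.
have m0 : 0 < Num.min d 1 by rewrite lt_min d0 ltr01.
have /cvgrPdist_lt/(_ _ m0) X := xx0.
near=> n.
have : `|x0 - x n| < Num.min d 1 by near: n.
rewrite lt_min => /andP[xd x1].
have Kx : K ((x n)%:C, t).
  exists (x n) => //=; rewrite in_itv /=.
  by move: x1; rewrite ltr_norml => /andP[? ?]; apply/andP; split; lra.
have : forall p, K p -> ball (f p.1 p.2) (e / 2)%:C (fn n p.1 p.2) by near: n.
move=> /(_ _ Kx); rewrite -ball_normE /= => gf.
have {}gf : normc (fn n (x n)%:C t - f (x n)%:C t) < e / 2.
  by rewrite normc_distC -ltc_norm.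
have gg : normc (f (x n)%:C t - f x0%:C t) < e / 2.
  by apply: Hd => //; rewrite -rmorphB normc_real distrC.
rewrite -(subrKA (f (x n)%:C t)).
by apply: le_lt_trans (ler_normcD _ _) _; lra.
Unshelve. all: by end_near. Qed.

(** Otherwise [v n] would eventually have modulus above half that of [l], while its bound tends to
    0. The proof uses [|C| + 1] as a positive substitute for [C], whose sign is arbitrary. *)
Lemma cvg0_dominated (C : R) (u v : nat -> R[i]) l :
  (forall n, normc (v n) <= C * normc (u n)) ->
  u n @[n --> \oo] --> (0 : R[i]) -> v n @[n --> \oo] --> l -> l = 0.
Proof.
move=> vu u0 vl; apply/eqP/negPn/negP => l0.
have N0 : 0 < normc l by rewrite normc_gt0.
have C0 : 0 < `|C| + 1 by rewrite ltr_wpDl.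
have N20 : 0 < normc l / 2 by rewrite divr_gt0.
have M0 : 0 < normc l / 2 / (`|C| + 1) by rewrite divr_gt0.
have /cvgcP/(_ _ M0) un := u0; have /cvgcP/(_ _ N20) vn := vl.
have [n [+ vln]] := filter_ex (filterI un vn).
rewrite subr0 ltr_pdivlMr// => uln.
have : normc l <= normc (v n) + normc (v n - l).
  by rewrite [normc (v n - l)]normc_distC -{1}(subrKC (v n) l) ler_normcD.
have : C * normc (u n) <= normc (u n) * (`|C| + 1).
  by rewrite mulrC ler_wpM2l ?normc_ge0//; have := ler_norm C; lra.
have := vu n; lra.
Qed.

End BoundaryDerivatives.

(** * Transport of the singular set by the limit flow *)

Theorem lemma3p1 (R : realType) (CE : R -> R) (Cc : R -> R -> R)
    (c1 c2 : R -> R) (T0 : R) (F Psi : R[i]%C -> R -> R[i]%C)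
    (P : R[i]%C -> R -> R) (h : R -> R -> R) :
  0 < T0 -> wu_solution CE Cc c1 c2 T0 F Psi P h ->
  forall t : R, t \in `[0, T0] ->
    singular_set Psi t = [set h a t | a in singular_set Psi 0].
Proof.
move=> T00 [c10 c20 idata [_ reg]] [Fe [Psie [Pe [he [heinv [approx]]]]]].
move=> [e [hinv [z [[e01 _] flow conv _]]]] t tT.
have zT : 0 \in `[0, T0] by rewrite in_itv /= lexx ltW.
have e0 n : 0 < e n by have /andP[] := e01 n.
have comparable n a := approx_inv_dz_comparable a c10 c20 (e0 n) (id_Psi idata)
  (approx _ (e01 n)).1 (approx _ (e01 n)).2 tT.
have [_ Vcvg _ _ _] := cv_closed conv.
have [hcvg _ _ _ _] := cv_flow conv.
have V0cvg (a : R) : bv (fun z t => (dz (Psie (e n)) z t)^-1) a%:C 0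
    @[n --> \oo] --> bv (fun z t => (dz Psi z t)^-1) a%:C 0.
  apply: (loc_unif_cvg_moving Vcvg (rs_invPsi_cont reg) zT).
  exact: cvg_cst.
have Vtcvg (a : R) :
    bv (fun z t => (dz (Psie (e n)) z t)^-1) (he (e n) a t)%:C t @[n --> \oo]
    --> bv (fun z t => (dz Psi z t)^-1) (h a t)%:C t.
  apply: (loc_unif_cvg_moving Vcvg (rs_invPsi_cont reg) tT).
  apply/cvgrPdist_lt => r r0.
  have U : [set (a, t)] `<=` slab [set: R] T0 by move=> _ ->.
  have := loc_unif_cvg_compact hcvg (@compact_set1 _ (a, t)) U r0.
  by apply: filterS => n /(_ _ erefl); rewrite -ball_normE.
(* Each direction uses one half of [comparable]: the sequence that tends to 0 dominates the other,
   whose limit must then vanish. *)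
have equiv a : singular_set Psi t (h a t) <-> singular_set Psi 0 a.
  split=> [Vt0|V00].
    move: (Vtcvg a); rewrite [X in _ --> X]Vt0 => /cvg0_dominated.
    apply; last exact: V0cvg.
    by move=> n; exact: (comparable n a).2.
  move: (V0cvg a); rewrite [X in _ --> X]V00 => /cvg0_dominated.
  apply; last exact: Vtcvg.
  by move=> n; exact: (comparable n a).1.
have [_ hinvK] := lf_h_inv flow tT.
(* Surjectivity of [h] at time [t] gives the remaining inclusion, as every [a'] is the image of
   [hinv a' t]. *)
apply/seteqP; split=> [a'|_ [a Sa <-]]; last exact/equiv.
by rewrite /= -{1}(hinvK a') => /equiv Sa; exists (hinv a' t).
Qed.
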